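(* Let $\phi\ge \tfrac12$ and let $\lambda,\beta,\mu\ge 1$. On any $(\lambda,\beta,\mu)$-separable smoothed combinatorial local optimization instance with parameters $M,\nu,\bar\nu$ and density bound $\phi$, the expected value (over the random cost vector $c$) of the maximum number of steps performed by standard local search — maximum taken over all starting configurations and all sequences of improving moves, i.e. the length of a longest directed path in the transition graph — is at most $$3\cdot \mu^{\beta}\,\lambda\,\nu^2\, M\log_2(M+1)\,\phi .$$
   Context: A combinatorial local optimization (CLO) instance consists of integers $M,\nu\ge 1$, $\bar\nu\ge 0$; a finite set of feasible configurations $\mathbf S\subseteq\{0,1,\dots,M\}^{\nu}\times\{0,1\}^{\bar\nu}$, where a configuration is written $s=(s^\bullet,s^\circ)$ with cost part $s^\bullet=(s_1,\dots,s_\nu)\in\{0,\dots,M\}^\nu$; a cost vector $c\in[-1,1]^\nu$; and a neighbourhood function $N:\mathbf S\to 2^{\mathbf S}$. The cost of $s$ is $C(s)=\sum_{i=1}^\nu c_i s_i$. The neighbourhood graph is the directed graph $G=(\mathbf S,E)$ with $E=\{(s,s'): s\in\mathbf S,\ s'\in N(s)\}$; the transition graph is its subgraph with edges $\{(s,s')\in E: C(s')<C(s)\}$. Standard local search starts at an arbitrary configuration and repeatedly moves to an arbitrary neighbour of strictly smaller cost, until none exists (a local minimum). In the smoothed model, each $c_i$ is drawn independently from a continuous distribution with density $f_i:[-1,1]\to[0,\phi]$ (the $f_i$ may be chosen adversarially). For $I\subseteq[\nu]$ and a vector $x$, $x_I$ denotes the subvector of components indexed by $I$. A covering $(\mathcal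 E,\mathcal I)$ consists of $\mathcal E\subseteq 2^E$ with $\bigcup_{T\in\mathcal E}T=E$ (transition clusters) and $\mathcal I\subseteq 2^{[\nu]}$ with $\bigcup_{I\in\mathcal I}I=[\nu]$ (coordinate clusters). For $T\subseteq E$, its core is $\mathrm{core}(T)=\{i\in[\nu]: s^\bullet_i\ne s'^\bullet_i \text{ for some }(s,s')\in T\}$, and its diversity with respect to $I\subseteq[\nu]$ is $\delta_I(T)=|\{s^\bullet_I-s'^\bullet_I:(s,s')\in T\}|$. The instance is $(\lambda,\beta,\mu)$-separable if it has a covering $(\mathcal E,\mathcal I)$ with $|\mathcal E|\le\lambda$ such that every $T\in\mathcal E$ satisfies: (a) there is $\mathcal I_T\subseteq\mathcal I$ with $|\mathcal I_T|\le\beta$ and $\mathrm{core}(T)\subseteq\bigcup_{I\in\mathcal I_T}I$; (b) $\max_{I\in\mathcal I}\delta_I(T)\le\mu$. *)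

(* Defs.v *)
From HB Require Import structures.
From mathcomp Require Import all_boot all_order all_algebra.
From mathcomp Require Import all_classical all_reals all_analysis.
Set Implicit Arguments. Unset Strict Implicit. Unset Printing Implicit Defensive.
Import Order.TTheory GRing.Theory Num.Theory.
Local Open Scope ring_scope.

Section CLO.
Variables (M nu nub : nat).

Definition cfg : finType :=
  ({ffun 'I_nu -> 'I_M.+1} * {ffun 'I_nub -> bool})%type.

Definition nbh_edges (S : {set cfg}) (N : cfg -> {set cfg}) : {set cfg * cfg} :=
  [set e | (e.1 \in S) && (e.2 \in N e.1)].

Definition cost (R : realType) (c : 'I_nu -> R) (s : cfg) : R :=
  \sum_(i < nu) c i * (nat_of_ord (s.1 i))%:R.

Definition trans_rel (R : realType) (c : 'I_nu -> R) (S : {set cfg})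
    (N : cfg -> {set cfg}) : rel cfg :=
  fun s s' => ((s, s') \in nbh_edges S N) && (cost c s' < cost c s).

Definition has_path_len (R : realType) (c : 'I_nu -> R) (S : {set cfg})
    (N : cfg -> {set cfg}) (n : nat) : bool :=
  [exists t : n.+1.-tuple cfg, path (trans_rel c S N) (thead t) (behead t)].

(* Length of a longest directed path in the transition graph (= maximum
   number of steps of standard local search).  Paths in the transition
   graph strictly decrease the cost, hence are simple and have fewer than
   #|cfg| edges, so the maximum over n <= #|cfg| is the true maximum. *)
Definition longest_path (R : realType) (c : 'I_nu -> R) (S : {set cfg})
    (N : cfg -> {set cfg}) : nat :=
  \max_(n < #|{: cfg}|.+1 | has_path_len c S N n) n.

Definition core (T : {set cfg * cfg}) : {set 'I_nu} :=
  [set i | [exists e in T, e.1.1 i != e.2.1 i]].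

(* diversity delta_I(T) = |{ s_I - s'_I : (s,s') in T }|; the subvector
   s_I - s'_I is encoded as the function equal to it on I and 0 off I. *)
Definition sub_diff (I : {set 'I_nu}) (e : cfg * cfg) : {ffun 'I_nu -> int} :=
  [ffun i : 'I_nu => if i \in I
                     then ((nat_of_ord (e.1.1 i))%:Z - (nat_of_ord (e.2.1 i))%:Z)%R
                     else 0%R].

Definition diversity (I : {set 'I_nu}) (T : {set cfg * cfg}) : nat :=
  size (undup [seq sub_diff I e | e <- enum T]).

Definition separable (lam beta mu : nat) (S : {set cfg}) (N : cfg -> {set cfg}) : Prop :=
  exists (Ecal : {set {set cfg * cfg}}) (Ical : {set {set 'I_nu}}),
    [/\ (forall e, (e \in nbh_edges S N) = [exists T in Ecal, e \in T]),
        (forall i : 'I_nu, [exists I in Ical, i \in I]),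
        (#|Ecal| <= lam)%N &
        (forall T, T \in Ecal ->
           (exists ITc : {set {set 'I_nu}},
               [/\ ITc \subset Ical, (#|ITc| <= beta)%N &
                   (forall i, i \in core T -> [exists I in ITc, i \in I])])
           /\ (forall I, I \in Ical -> (diversity I T <= mu)%N))].

Definition clo_instance (S : {set cfg}) (N : cfg -> {set cfg}) : Prop :=
  forall s, s \in S -> N s \subset S.

End CLO.

Section Smoothed.
Local Open Scope classical_set_scope.
Local Open Scope ereal_scope.

Definition smoothed_costs (R : realType) (d : measure_display)
    (Omega : measurableType d) (P : probability Omega R) (nu : nat)
    (phi : R) (c : 'I_nu -> Omega -> R) : Prop :=
  (forall i, measurable_fun setT (c i)) /\
  (exists f : 'I_nu -> R -> R,
     (forall i, measurable_fun setT (f i)) /\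
     (forall i (x : R), x \in `[(-1)%R, 1%R] -> (0 <= f i x <= phi)%R) /\
     (forall i (A : set R), measurable A ->
        P (c i @^-1` A) = \int[lebesgue_measure]_(x in A `&` `[(-1)%R, 1%R]) (f i x)%:E)) /\
  (forall A : 'I_nu -> set R, (forall i, measurable (A i)) ->
     P (\bigcap_(i in [set: 'I_nu]) (c i @^-1` A i)) = \prod_(i < nu) P (c i @^-1` A i)).

End Smoothed.

(* Main.v *)
Require Import Defs.
From HB Require Import structures.
From mathcomp Require Import all_boot all_order all_algebra.
From mathcomp Require Import all_classical all_reals all_analysis.
From mathcomp Require Import measurable_realfun ring lra.
Import Order.TTheory GRing.Theory Num.Theory.
Local Open Scope ring_scope.

Set Implicit Arguments.
Unset Strict Implicit.

(** A step of local search changes the cost by the scalar product of [c] with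
    an integer vector [eta = s - s'].  Inside a transition cluster [eta] is
    determined by its restrictions to the at most [beta] coordinate clusters
    covering the core, so at most [lam * mu ^ beta] vectors [eta] occur.  If
    [eta i <> 0] then, the other costs being fixed, [0 < <eta, c> <= eps]
    confines [c i] to a segment of length at most [eps], so this event has
    probability at most [phi * eps].  Independence is only given on boxes;
    instead of Fubini's theorem, the other costs are rounded to a grid of mesh
    [1 / m] and [m] is sent to infinity.

    All costs lie in a range of width [nu * M], hence a run of at least [t]
    steps contains a step of size at most [nu * M / t], which has probability
    at most [lam * mu ^ beta * phi * nu * M / t].  A run has fewer than
    [(M + 1) ^ nu] steps since the cost only depends on the cost part, and
    summing over [t] gives a harmonic sum of order [nu * ln (M + 1)]. *)

(** * Counting distinct values of maps *)

(** On [s] each value of [g] determines the value of [f]. *)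
Lemma size_undup_map_factor (T U V : eqType) (f : T -> U) (g : T -> V)
    (s : seq T) :
  {in s &, forall x y, g x = g y -> f x = f y} ->
  (size (undup (map f s)) <= size (undup (map g s)))%N.
Proof.
elim: s => [//|x s IH] fg /=.
have {}IH : (size (undup (map f s)) <= size (undup (map g s)))%N.
  by apply: IH => y z ys zs; apply: fg; rewrite inE ?ys ?zs orbT.
have [gx|gx] := boolP (g x \in map g s).
  have [y ys gxy] := mapP gx.
  rewrite (fg x y) ?inE ?eqxx ?ys ?orbT//.
  by rewrite map_f.
case: ifP => _ /=; last by [].
exact: leqW.
Qed.

(** Each list of values lies in the product of the value sets of the maps [g j]. *)
Lemma size_undup_map_seq (T U : eqType) (J : Type) (g : J -> T -> U)
    (l : seq J) (s : seq T) :
  (size (undup [seq [seq g j e | j <- l] | e <- s])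
     <= \prod_(j <- l) size (undup (map (g j) s)))%N.
Proof.
elim: l => [|j l IH].
  rewrite big_nil; apply: (@uniq_leq_size _ _ [:: [::]]); first exact: undup_uniq.
  by move=> y; rewrite mem_undup => /mapP[e _ ->]; rewrite inE.
rewrite big_cons; apply: leq_trans (leq_mul (leqnn _) IH).
rewrite -(size_allpairs cons); apply: uniq_leq_size; first exact: undup_uniq.
move=> y; rewrite mem_undup => /mapP[e es ->] /=.
apply/allpairsP; exists (g j e, [seq g j e | j <- l]) => /=; split => //.
- by rewrite mem_undup; apply: map_f.
- by rewrite mem_undup; apply: (map_f (fun e => [seq g j e | j <- l])).
Qed.

(** * Difference vectors and improving paths *)

Section Combinatorics.
Variables (R : realType) (M nu nub : nat).
Implicit Types (S : {set cfg M nu nub}) (N : cfg M nu nub -> {set cfg M nu nub}).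
Implicit Types (T : {set cfg M nu nub * cfg M nu nub}).

(** Differences vanish off the core, so a full difference is determined by its restrictions to the
    clusters in [J]. As [mu] is positive, fewer than [beta] clusters do no harm. *)
Lemma diversity_core_cover T (J : {set {set 'I_nu}}) (mu beta : nat) :
  (1 <= mu)%N -> (#|J| <= beta)%N ->
  (forall i, i \in core T -> [exists I in J, i \in I]) ->
  (forall I, I \in J -> diversity I T <= mu)%N ->
  (diversity [set: 'I_nu] T <= mu ^ beta)%N.
Proof.
move=> mu1 Jb cov div.
apply: (@leq_trans (\prod_(I <- enum J) diversity I T)).
  apply: (leq_trans _ (@size_undup_map_seq _ _ _ (@sub_diff M nu nub)
                         (enum J) (enum T))).
  apply: size_undup_map_factor => e e' /[!mem_enum] eT e'T /eq_in_map ee'.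
  apply/ffunP => i; rewrite !ffunE finset.in_setT.
  have [/cov/existsP[I /andP[IJ iI]]|] := boolP (i \in core T).
    by have /ffunP/(_ i) := ee' I (etrans (mem_enum _ _) IJ); rewrite !ffunE iI.
  rewrite inE negb_exists => /forallP ncore.
  have same u : u \in T -> u.1.1 i = u.2.1 i.
    by move=> uT; have := ncore u; rewrite uT/= negbK => /eqP.
  by rewrite (same e)// (same e')// !subrr.
apply: (@leq_trans (\prod_(I <- enum J) mu)).
  rewrite !big_enum; apply: leq_prod => I; exact: div.
by rewrite big_enum prod_nat_const leq_pexp2l.
Qed.

Lemma separable_differences (lam beta mu : nat) S N :
  (1 <= mu)%N -> separable lam beta mu S N ->
  exists2 D : seq {ffun 'I_nu -> int}, (size D <= lam * mu ^ beta)%N &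
    {in nbh_edges S N, forall e, sub_diff [set: 'I_nu] e \in D}.
Proof.
move=> mu1 [Ecal [Ical [covE _ lamE sepE]]].
pose diffs T := undup [seq sub_diff [set: 'I_nu] e | e <- enum T].
exists (flatten [seq diffs T | T <- enum Ecal]); last first.
  move=> e; rewrite covE => /existsP[T /andP[TE eT]].
  apply/flattenP; exists (diffs T).
    by apply: map_f; rewrite mem_enum.
  by rewrite mem_undup; apply: map_f; rewrite mem_enum.
rewrite size_flatten /shape -map_comp sumnE big_map big_enum /=.
apply: (@leq_trans (\sum_(T in Ecal) mu ^ beta)).
  apply: leq_sum => T TE; have [[J [sub Jb cov]] div] := sepE T TE.
  apply: diversity_core_cover Jb cov _ => // I IJ.
  by apply: div; apply: (fintype.subsetP sub).
by rewrite sum_nat_const leq_mul2r lamE orbT.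
Qed.

Variable c : 'I_nu -> R.

Lemma cost_diff (s s' : cfg M nu nub) :
  cost c s - cost c s' =
  \sum_(i < nu) (sub_diff [set: 'I_nu] (s, s') i)%:~R * c i.
Proof.
rewrite /cost -sumrB; apply: eq_bigr => i _.
by rewrite ffunE finset.in_setT /= intrB !pmulrn mulrBl ![c i * _]mulrC.
Qed.

Lemma cost_range (s s' : cfg M nu nub) : (forall i, -1 <= c i <= 1) ->
  cost c s - cost c s' <= (nu * M)%:R.
Proof.
move=> c1; rewrite /cost -sumrB.
apply: (@le_trans _ _ (\sum_(i < nu) M%:R)); last first.
  by rewrite sumr_const card_ord natrM mulr_natl.
apply: ler_sum => i _; have /andP[c1l c1r] := c1 i.
have := ltn_ord (s.1 i); have := ltn_ord (s'.1 i).
rewrite !ltnS -!(ler_nat R).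
move: (ler0n R (s.1 i)) (ler0n R (s'.1 i)).
set a := _%:R; set b := _%:R; set m := _%:R => *; nra.
Qed.

(** The drops telescope; the path must be nonempty for the inequality to be strict. *)
Lemma path_cost_drop S N eps x p :
  {in nbh_edges S N, forall e, cost c e.2 < cost c e.1 ->
     eps < cost c e.1 - cost c e.2} ->
  path (trans_rel c S N) x p -> (0 < size p)%N ->
  eps *+ size p < cost c x - cost c (last x p).
Proof.
move=> drop; elim: p x => [//|y p IH] x /= /andP[/andP[xyE xy]].
have := drop _ xyE xy; case: p IH => [//|z p] IH /= step /IH /(_ isT) /=.
rewrite mulrS; lra.
Qed.

(** The cost strictly decreases along the path and is a function of the cost part alone, so the cost
    parts visited are pairwise distinct. *)
Lemma path_size_lt S N x p :
  path (trans_rel c S N) x p -> (size p < M.+1 ^ nu)%N.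
Proof.
move=> xp; have -> : (M.+1 ^ nu)%N = #|{ffun 'I_nu -> 'I_M.+1}|.
  by rewrite card_ffun !card_ord.
have : uniq (map fst (x :: p)).
  apply: (@map_uniq _ _ (fun u : {ffun 'I_nu -> 'I_M.+1} =>
    \sum_(i < nu) c i * (nat_of_ord (u i))%:R)).
  rewrite -map_comp.
  apply: (@sorted_uniq _ (fun a b : R => b < a)).
  - by move=> a b d; move=> ? ?; lra.
  - by move=> a; rewrite ltxx.
  rewrite sorted_map /=; apply: sub_path xp => s s' /andP[_].
  by rewrite /cost /=.
move=> /card_uniqP; rewrite size_map /= => <-.
exact: max_card.
Qed.

Lemma longest_pathP S N :
  exists x p, size p = longest_path c S N /\ path (trans_rel c S N) x p.
Proof.
(* A path of length 0 always exists, so the maximum is attained. *)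
pose x : cfg M nu nub := (finfun (fun=> ord0), finfun (fun=> false)).
have h0 : has_path_len c S N (@ord0 #|{: cfg M nu nub}|).
  by apply/existsP; exists [tuple x].
rewrite /longest_path (bigop.bigmax_eq_arg ord0 h0).
case: arg_maxnP => //= n /existsP[t tp] _.
by exists (thead t), (behead t); rewrite size_behead size_tuple.
Qed.

End Combinatorics.

(** * Harmonic sums *)

Lemma harmonic_le_ln (R : realType) (K : nat) :
  \sum_(k < K.+1) (k.+1%:R : R)^-1 <= 1 + ln K.+1%:R.
Proof.
elim: K => [|K IH]; first by rewrite big_ord1 ln1 invr1 addr0.
rewrite big_ord_recr /=.
have a0 : 0 < K.+1%:R :> R by [].
have b0 : 0 < K.+2%:R :> R by [].
have e : 1 + - (K.+2%:R : R)^-1 = K.+1%:R / K.+2%:R.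
  apply: (mulIf (lt0r_neq0 b0)); rewrite divfK ?lt0r_neq0// mulrDl mul1r.
  by rewrite mulNr mulVf ?lt0r_neq0// -natr1 addrK.
(* The inequality [ln (1 + x) <= x] at [x = - 1 / (K + 2)] bounds the new term by
   [ln (K + 2) - ln (K + 1)]. *)
have : ln (1 + - (K.+2%:R : R)^-1) <= - K.+2%:R^-1.
  by apply: le_ln1Dx; rewrite ltrN2 invf_lt1// ltr1n.
rewrite e ln_div ?posrE//.
move: IH; set h := \sum_(_ < _) _; set u := ln _; set v := ln _; set t := _^-1.
lra.
Qed.

(** * Probability of a small improvement *)

Section Probability.
Local Open Scope classical_set_scope.
Variables (R : realType) (d : measure_display) (Omega : measurableType d).

(* For arbitrary functions monotonicity is read off the supremum over simple
   functions that defines the integral. *)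
Lemma ge0_le_integral_nonmeasurable (mu : {measure set Omega -> \bar R})
    (f g : Omega -> \bar R) :
  (forall w, 0 <= f w)%E -> (forall w, f w <= g w)%E ->
  (\int[mu]_w f w <= \int[mu]_w g w)%E.
Proof.
move=> f0 fg; have g0 w : (0 <= g w)%E := le_trans (f0 w) (fg w).
rewrite !ge0_integralTE//; apply: le_ereal_sup => _ [h hf <-].
by exists h => // w; apply: le_trans (hf w) (fg w).
Qed.

Lemma measure_bigsetU_le (mu : {measure set Omega -> \bar R}) (I : Type)
    (s : seq I) (Q : pred I) (A : I -> set Omega) :
  (forall i, measurable (A i)) ->
  (mu (\big[setU/set0]_(i <- s | Q i) A i) <= \sum_(i <- s | Q i) mu (A i))%E.
Proof.
move=> mA; elim: s => [|i s IH]; first by rewrite !big_nil measure0.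
rewrite !big_cons; case: ifP => // _.
apply: le_trans (leeD2l _ IH); apply: measureU2 => //.
exact: bigsetU_measurable.
Qed.

Variables (P : probability Omega R) (nu : nat) (phi : R) (c : 'I_nu -> Omega -> R).
Hypothesis phi0 : 0 <= phi.
Hypothesis smooth : smoothed_costs P phi c.

Lemma smoothed_measurable i : measurable_fun setT (c i).
Proof. by have [mc _] := smooth. Qed.

Lemma smoothed_preimage_measurable i (A : set R) :
  measurable A -> measurable (c i @^-1` A).
Proof.
by move=> mA; rewrite -[X in measurable X]setTI; apply: smoothed_measurable.
Qed.

Lemma smoothed_segment_le i (x r : R) : 0 <= r ->
  (P (c i @^-1` `[(x - r)%R, (x + r)%R]) <= (phi * (2 * r))%:E)%E.
Proof.
move=> r0; have [_ [[f [mf [f01 fP]]] _]] := smooth.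
rewrite fP//.
have mD : measurable (`[x - r, x + r] `&` `[(-1)%R, 1%R] : set R).
  by apply: measurableI; exact: measurable_itv.
apply: (@le_trans _ _ (\int[lebesgue_measure]_(y in
    `[(x - r)%R, (x + r)%R] `&` `[(-1)%R, 1%R]) cst phi%:E y)%E).
  apply: ge0_le_integral => //.
  - by move=> y [_ /mem_set/(f01 i) /andP[]]; rewrite lee_fin.
  - apply/measurable_EFinP; apply: measurable_funS (mf i) => //.
  - by move=> y [_ /mem_set/(f01 i) /andP[]]; rewrite lee_fin.
rewrite integral_cst// EFinM; apply: lee_wpmul2l; first by rewrite lee_fin.
apply: (@le_trans _ _ (lebesgue_measure (`[x - r, x + r] : set R))).
  by apply: le_measure; rewrite ?inE//; exact: subIsetl.
rewrite lebesgue_measure_itv /= lte_fin; case: ifP => _.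
  by rewrite -EFinB lee_fin; lra.
by rewrite lee_fin; lra.
Qed.

(** The densities confine the costs to [-1, 1] only almost surely; this is the exceptional event,
    split off wherever pointwise bounds are needed. *)
Definition out_of_range : set Omega :=
  \big[setU/set0]_(i < nu) c i @^-1` (~` `[(-1)%R, 1%R]).

Lemma out_of_range_measurable : measurable out_of_range.
Proof.
apply: bigsetU_measurable => i _; apply: smoothed_preimage_measurable.
exact: measurableC.
Qed.

Lemma out_of_range_null : P out_of_range = 0%E.
Proof.
apply/eqP; rewrite eq_le measure_ge0 andbT.
apply: le_trans (measure_bigsetU_le _ _ _ _) _.
  by move=> i; apply: smoothed_preimage_measurable; apply: measurableC.
rewrite big1// => i _; have [_ [[f [_ [_ fP]]] _]] := smooth.
have mI : measurable (~` `[(-1)%R, 1%R] : set R) by exact: measurableC.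
by apply: etrans (fP i _ mI) _; rewrite setICl integral_set0.
Qed.

Lemma not_out_of_range w : ~ out_of_range w -> forall i, -1 <= c i w <= 1.
Proof.
move=> nw i; apply: contrapT => ci; apply: nw.
rewrite /out_of_range -bigcup_seq; exists i => //=; first exact: mem_index_enum.
Qed.

Definition small_gap (a : 'I_nu -> R) (eps : R) : set Omega :=
  [set w | 0 < \sum_(i < nu) a i * c i w <= eps].

Lemma small_gap_measurable a eps : measurable (small_gap a eps).
Proof.
have -> : small_gap a eps =
    setT `&` (fun w => \sum_(i < nu) a i * c i w) @^-1` `]0, eps].
  by rewrite setTI; apply/seteqP; split => w; rewrite /= in_itv.
apply: measurable_sum => // i.
by apply: measurable_funM => //; exact: smoothed_measurable.
Qed.

(** * Rounding all costs but one to a grid *)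

Section Grid.
Variables (m : nat) (a : 'I_nu -> R) (i : 'I_nu) (eps : R).
Hypothesis m0 : (0 < m)%N.
Hypothesis ai1 : 1 <= `|a i|.
Hypothesis eps0 : 0 <= eps.

Definition grid_point (k : nat) : R := k%:R / m%:R - 1.
(** Half-open, so that distinct cells are disjoint. *)
Definition grid_cell (k : nat) : set R := `[grid_point k, grid_point k.+1[.
(** [wid] bounds the error in the scalar product from rounding the costs other than [c i]. Once
    these are rounded to cell [k], a small gap forces [c i] to within [rad] of [center k]. *)
Let wid : R := (\sum_(j < nu) `|a j|) / m%:R.
Let rad : R := eps / 2 + wid.
Let center (k : {ffun 'I_nu -> 'I_(2 * m).+1}) : R :=
  (eps / 2 - \sum_(j < nu | j != i) a j * grid_point (k j)) / a i.
(* Coordinate [i] of [k] plays no role; [small_gap_cell_box] fixes it to [ord0]. *)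
Let cell_box (k : {ffun 'I_nu -> 'I_(2 * m).+1}) (j : 'I_nu) : set R :=
  if j == i then `[center k - rad, center k + rad] else grid_cell (k j).

Let wid0 : 0 <= wid. Proof. by rewrite divr_ge0 ?sumr_ge0. Qed.
Let rad0 : 0 <= rad. Proof. by apply: addr_ge0 => //; apply: divr_ge0. Qed.

Lemma grid_cell_measurable k : measurable (grid_cell k).
Proof. exact: measurable_itv. Qed.

Lemma grid_cell_sum_le1 j :
  (\sum_(k < (2 * m).+1) P (c j @^-1` grid_cell k) <= 1)%E.
Proof.
rewrite -(measure_bigsetU_ord _ xpredT).
- apply: probability_le1; apply: bigsetU_measurable => k _.
  apply: smoothed_preimage_measurable; exact: grid_cell_measurable.
- by move=> k; apply: smoothed_preimage_measurable; exact: grid_cell_measurable.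
move=> k l _ _ [w []]; rewrite /grid_cell /= !in_itv /=.
move=> /andP[k1 k2] /andP[l1 l2].
have mR : 0 < m%:R :> R by rewrite ltr0n.
have lt u v : grid_point u < grid_point v -> (u < v)%N.
  by rewrite /grid_point ltrD2r ltr_pM2r ?invr_gt0// ltr_nat.
apply: val_inj; apply/eqP; rewrite eqn_leq.
have := lt _ _ (le_lt_trans k1 l2); have := lt _ _ (le_lt_trans l1 k2).
by rewrite !ltnS => -> ->.
Qed.

Lemma grid_cell_cover (x : R) : -1 <= x <= 1 ->
  exists k : 'I_(2 * m).+1, grid_cell k x.
Proof.
move=> /andP[x1 x2]; have mR : 0 < m%:R :> R by rewrite ltr0n.
have y0 : 0 <= (x + 1) * m%:R by rewrite mulr_ge0 ?ler0n//; lra.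
have /andP[t1 t2] := truncn_itv y0.
(* The endpoint [x = 1] has index [2 * m], hence [2 * m + 1] cells. *)
have tm : (Num.trunc ((x + 1) * m%:R) < (2 * m).+1)%N.
  rewrite ltnS -(ler_nat R); apply: le_trans t1 _.
  by rewrite natrM; apply: ler_wpM2r; [exact: ler0n|lra].
exists (Ordinal tm); rewrite /grid_cell /= in_itv /= /grid_point lerBlDr ltrBrDr.
by rewrite ler_pdivrMr// t1 ltr_pdivlMr.
Qed.

Lemma grid_cell_dist (k : nat) x : grid_cell k x ->
  `|x - grid_point k| <= m%:R^-1.
Proof.
rewrite /grid_cell /= in_itv /= /grid_point -natr1 => /andP[x1 x2].
rewrite ler_norml; move: x1 x2; rewrite mulrDl mul1r => x1 x2.
have : 0 <= (m%:R : R)^-1 by rewrite invr_ge0.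
by move=> ?; apply/andP; split; lra.
Qed.

Lemma small_gap_cell_box w : small_gap a eps w -> ~ out_of_range w ->
  exists2 k, k \in family (fun j => if j == i then pred1 ord0 else predT) &
    forall j, cell_box k j (c j w).
Proof.
move=> /andP[g0 g1] /not_out_of_range w1.
have /boolp.choice[k0 k0P] : forall j, exists u : 'I_(2 * m).+1,
    grid_cell u (c j w).
  by move=> j; apply: grid_cell_cover.
pose k := [ffun j => if j == i then ord0 else k0 j].
exists k.
  by apply/familyP => j; rewrite ffunE; case: ifP.
move=> j; rewrite /cell_box; case: eqP => [->{j}|/eqP ji]; last first.
  by rewrite ffunE (negbTE ji).
have dist : `|\sum_(j < nu | j != i) a j * c j w
    - \sum_(j < nu | j != i) a j * grid_point (k j)| <= wid.
  rewrite -sumrB; apply: le_trans (ler_norm_sum _ _ _) _.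
  rewrite /wid mulr_suml [leRHS](bigD1 i)//= -[leLHS]add0r lerD//.
  apply: ler_sum => j ji; rewrite -mulrBr normrM ler_wpM2l//.
  by rewrite ffunE (negbTE ji); apply: grid_cell_dist.
move: g0 g1; rewrite (bigD1 i)//= => g0 g1.
have ai0 : a i != 0 by rewrite -normr_gt0; apply: lt_le_trans ai1.
rewrite in_itv /= -ler_distlC distrC.
have -> : c i w - center k =
    (a i * c i w - (eps / 2 - \sum_(j < nu | j != i) a j * grid_point (k j))) / a i.
  by rewrite /center; field.
rewrite normrM normfV ler_pdivrMr ?(lt_le_trans _ ai1)//.
(* Since [a i] has absolute value at least 1, dividing by it does not lengthen the segment. *)
apply: (@le_trans _ _ rad); last by rewrite ler_peMr.
move: dist; rewrite !ler_norml /rad => /andP[d1 d2].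
by apply/andP; split; lra.
Qed.

Lemma cell_box_measurable k j : measurable (cell_box k j).
Proof. by rewrite /cell_box; case: ifP => _; exact: measurable_itv. Qed.

(** The boxes cover the event up to a null set, and independence turns each box into a product. The
    bound for coordinate [i] is the same for every center, so the sum over boxes factors; each other
    coordinate contributes at most 1. *)
Lemma small_gap_grid_le :
  (P (small_gap a eps) <= (phi * (eps + 2 * wid))%:E)%E.
Proof.
have [_ [_ indep]] := smooth.
pose B k := \bigcap_(j in [set: 'I_nu]) (c j @^-1` cell_box k j).
have mpre j A : measurable A -> measurable (c j @^-1` A).
  exact: smoothed_preimage_measurable.
have mB k : measurable (B k).
  apply: fin_bigcap_measurable; first exact: finite_finset.
  by move=> j _; apply: mpre; apply: cell_box_measurable.
pose Q (j : 'I_nu) : pred 'I_(2 * m).+1 := if j == i then pred1 ord0 else predT.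
pose F (j : 'I_nu) (u : 'I_(2 * m).+1) : R :=
  if j == i then phi * (eps + 2 * wid) else fine (P (c j @^-1` grid_cell u)).
have Pfin A : measurable A -> P A \is a fin_num by exact: fin_num_measure.
have boxF k j : (P (c j @^-1` cell_box k j) <= (F j (k j))%:E)%E.
  rewrite /cell_box /F; case: eqP => [->|_].
    apply: le_trans (smoothed_segment_le _ _ rad0) _.
    by rewrite lee_fin ler_wpM2l// /rad; lra.
  by rewrite fineK// Pfin//; apply: mpre; exact: grid_cell_measurable.
have cover : small_gap a eps `<=`
    out_of_range `|` \big[setU/set0]_(k in family Q) B k.
  move=> w gw; have [ow|ow] := pselect (out_of_range w); [by left|right].
  have [k kQ kB] := small_gap_cell_box gw ow.
  rewrite -bigcup_seq_cond; exists k; last by move=> j _; exact: kB.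
  by rewrite /= mem_index_enum.
apply: (le_trans (le_measure P _ _ cover)).
- by rewrite inE; apply: small_gap_measurable.
- rewrite inE; apply: measurableU; first exact: out_of_range_measurable.
  exact: bigsetU_measurable.
apply: le_trans (measureU2 _ _ _) _.
- exact: out_of_range_measurable.
- exact: bigsetU_measurable.
rewrite [X in (X + _)%E]out_of_range_null add0e.
apply: le_trans (measure_bigsetU_le _ _ _ mB) _.
apply: (@le_trans _ _ (\sum_(k in family Q) (\prod_(j < nu) F j (k j))%:E)%E).
  apply: lee_sum => k _; have mbox j := cell_box_measurable k j.
  rewrite [leLHS](indep _ mbox).
  rewrite (eq_bigr (fun j => (fine (P (c j @^-1` cell_box k j)))%:E)); last first.
    by move=> j _; rewrite fineK// Pfin//; apply: mpre.
  rewrite prodEFin lee_fin; apply: ler_prod => j _.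
  rewrite fine_ge0//= -lee_fin fineK//.
  by rewrite Pfin//; apply: mpre.
(* Distributivity exchanges the sum over index vectors with the product over coordinates; at [i]
   only the index [ord0] remains. *)
rewrite sumEFin lee_fin -(bigA_distr_big_dep Q F) (bigD1 i)//=.
rewrite /Q /F eqxx big_pred1_eq -[leRHS]mulr1 ler_wpM2l//.
  by rewrite mulr_ge0// addr_ge0// mulr_ge0.
apply: prodr_ile1 => j ji; rewrite (negbTE ji); apply/andP; split.
  by apply: sumr_ge0 => u _; rewrite fine_ge0.
rewrite -lee_fin -sumEFin; apply: le_trans (grid_cell_sum_le1 j).
apply: lee_sum => u _; rewrite fineK// Pfin//.
by apply: mpre; exact: grid_cell_measurable.
Qed.

End Grid.

(** * Refining the grid and collecting the gap events *)

Lemma small_gap_le (a : 'I_nu -> R) i eps : 1 <= `|a i| -> 0 <= eps ->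
  (P (small_gap a eps) <= (phi * eps)%:E)%E.
Proof.
move=> ai1 eps0; have Pfin : P (small_gap a eps) \is a fin_num.
  by apply: fin_num_measure; apply: small_gap_measurable.
rewrite -(fineK Pfin) lee_fin; apply/ler_addgt0Pr => e e0.
pose L := phi * (2 * \sum_(j < nu) `|a j|).
have L0 : 0 <= L by rewrite !mulr_ge0// sumr_ge0.
(* Chosen so that the discretization error [L / m] is at most [e]. *)
pose m := (Num.trunc (L / e)).+1.
have m0 : 0 < m%:R :> R by rewrite ltr0n.
rewrite -lee_fin (fineK Pfin).
apply: le_trans (@small_gap_grid_le m a i eps isT ai1 eps0) _.
have : L / m%:R <= e.
  rewrite ler_pdivrMr// mulrC -ler_pdivrMr//; apply: ltW.
  by have /andP[] := truncn_itv (divr_ge0 L0 (ltW e0)).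
by rewrite lee_fin mulrDr /L lerD2l !mulrA.
Qed.

(** A nonzero integer entry has absolute value at least 1; for the zero vector the event is empty
    because gaps are strictly positive. *)
Lemma small_gap_int_le (eta : 'I_nu -> int) eps : 0 <= eps ->
  (P (small_gap (fun i => (eta i)%:~R) eps) <= (phi * eps)%:E)%E.
Proof.
move=> eps0; have [i etai|eta0] := pickP (fun i => eta i != 0).
  apply: (small_gap_le (i := i)) => //=.
  by rewrite -intr_norm (ler_int _ 1); rewrite -gtz0_ge1 normr_gt0.
rewrite (_ : small_gap _ _ = set0) ?measure0 ?lee_fin ?mulr_ge0//.
apply/seteqP; split => // w /andP[]; rewrite big1 ?ltxx// => i _.
by have /negbFE/eqP -> := eta0 i; rewrite mul0r.
Qed.

Definition gap_event (D : seq {ffun 'I_nu -> int}) (eps : R) : set Omega :=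
  out_of_range `|`
  \big[setU/set0]_(eta <- D) small_gap (fun i => (eta i)%:~R) eps.

Lemma gap_event_measurable D eps : measurable (gap_event D eps).
Proof.
apply: measurableU; first exact: out_of_range_measurable.
by apply: bigsetU_measurable => eta _; exact: small_gap_measurable.
Qed.

Lemma gap_event_le D eps : 0 <= eps ->
  (P (gap_event D eps) <= ((size D)%:R * (phi * eps))%:E)%E.
Proof.
move=> eps0; have mgap (eta : {ffun 'I_nu -> int}) :
  measurable (small_gap (fun i => (eta i)%:~R) eps) by exact: small_gap_measurable.
apply: le_trans (measureU2 _ _ _) _.
- exact: out_of_range_measurable.
- exact: bigsetU_measurable.
rewrite [X in (X + _)%E]out_of_range_null add0e.
apply: le_trans (measure_bigsetU_le _ _ _ mgap) _.
apply: (@le_trans _ _ (\sum_(eta <- D) (phi * eps)%:E)%E).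
  by apply: lee_sum => eta _; exact: small_gap_int_le.
by rewrite sumEFin lee_fin big_const_seq count_predT iter_addr_0 mulr_natl.
Qed.

End Probability.

(** * Expected length of a longest path *)

(** Every [t] below the path length makes event [t] occur, so at least that many indicators equal
    1. *)
Lemma longest_path_le_sum_gap (R : realType) (d : measure_display)
    (Omega : measurableType d) (M nu nub : nat) (S : {set cfg M nu nub})
    (N : cfg M nu nub -> {set cfg M nu nub}) (c : 'I_nu -> Omega -> R)
    (D : seq {ffun 'I_nu -> int}) (w : Omega) :
  {in nbh_edges S N, forall e, sub_diff [set: 'I_nu] e \in D} ->
  (longest_path (fun i => c i w) S N)%:R <=
    \sum_(t < M.+1 ^ nu) \1_(gap_event c D ((nu * M)%:R / t.+1%:R)) w :> R.
Proof.
move=> DE; have [x [p [<- xp]]] := longest_pathP (fun i => c i w) S N.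
have pK := path_size_lt xp.
have gap (t : nat) : (t < size p)%N -> gap_event c D ((nu * M)%:R / t.+1%:R) w.
  move=> tp; apply: contrapT => /not_orP[/not_out_of_range c1 ngap].
  have t0 : 0 < t.+1%:R :> R by [].
  have drop : {in nbh_edges S N, forall e,
      cost (fun i => c i w) e.2 < cost (fun i => c i w) e.1 ->
      (nu * M)%:R / t.+1%:R <
        cost (fun i => c i w) e.1 - cost (fun i => c i w) e.2}.
    move=> e eE lt_e; rewrite ltNge; apply/negP => le_e; apply: ngap.
    rewrite -bigcup_seq; exists (sub_diff [set: 'I_nu] e); first exact: DE.
    move: le_e lt_e; rewrite /small_gap /= -subr_gt0 cost_diff.
    by rewrite -surjective_pairing => -> ->.
  (* If every improvement exceeded [nu * M / (t + 1)], a path of at least [t + 1] steps would drop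
     by more than the range [nu * M]. *)
  have := path_cost_drop drop xp (leq_ltn_trans (leq0n t) tp).
  apply/negP; rewrite -leNgt; apply: le_trans (cost_range _ _ c1) _.
  rewrite -[leRHS]mulr_natr -mulrA ler_peMr// mulrC ler_pdivlMr// mul1r ler_nat.
  exact: tp.
apply: (@le_trans _ _ (\sum_(t < M.+1 ^ nu | (t < size p)%N) 1)).
  by rewrite -(big_ord_widen _ (fun=> 1)) ?(ltnW pK)// sumr_const card_ord.
rewrite [leLHS]big_mkcond; apply: ler_sum => t _; rewrite indicE.
by case: ifP => // tp; rewrite mem_set//; exact: gap.
Qed.

(** As [ln 2 <= 1] and [M + 1 >= 2], both 1 and [nu * ln (M + 1)] are at most
    [nu * log2 (M + 1)]. *)
Lemma harmonic_log2_le (R : realType) (M nu : nat) : (1 <= M)%N -> (1 <= nu)%N ->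
  \sum_(k < M.+1 ^ nu) (k.+1%:R : R)^-1 <= 3 * nu%:R * (ln M.+1%:R / ln 2).
Proof.
move=> M1 nu1; have K0 : (0 < M.+1 ^ nu)%N by rewrite expn_gt0.
rewrite -(prednK K0); apply: le_trans (harmonic_le_ln _ _) _; rewrite (prednK K0).
rewrite natrX lnXn// -[_ *+ nu]mulr_natl.
have l2 : 0 < ln 2 :> R by rewrite ln_gt0// ltr1n.
have l21 : ln 2 <= 1 :> R.
  by have := @le_ln1Dx R 1; rewrite (_ : 1 + 1 = 2)//; apply; lra.
have lM : ln 2 <= ln M.+1%:R :> R by rewrite ler_ln ?posrE// ler_nat.
have n1 : 1 <= nu%:R :> R by rewrite ler1n.
set L := ln M.+1%:R in lM *.
have q1 : 1 <= L / ln 2 by rewrite ler_pdivlMr// mul1r.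
have qL : L <= L / ln 2.
  by rewrite ler_pdivlMr// ler_piMr// (le_trans (ltW l2)).
have nq : 1 <= nu%:R * (L / ln 2) by rewrite -[leLHS]mulr1 ler_pM.
have nqL : nu%:R * L <= nu%:R * (L / ln 2) by rewrite ler_wpM2l.
rewrite -mulrA.
by move: (nu%:R * L) (nu%:R * (L / ln 2)) nq nqL => u v; lra.
Qed.

Unset Implicit Arguments.

Theorem theorem3p2 (R : realType) (d : measure_display) (Omega : measurableType d)
    (P : probability Omega R) (phi : R) (lam beta mu M nu nub : nat)
    (S : {set cfg M nu nub}) (N : cfg M nu nub -> {set cfg M nu nub})
    (c : 'I_nu -> Omega -> R) :
  2^-1 <= phi -> (1 <= lam)%N -> (1 <= beta)%N -> (1 <= mu)%N ->
  (1 <= M)%N -> (1 <= nu)%N ->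
  clo_instance S N ->
  separable lam beta mu S N ->
  smoothed_costs P phi c ->
  (\int[P]_w ((longest_path (fun i => c i w) S N)%:R)%:E
     <= (3 * (mu ^ beta)%:R * lam%:R * (nu ^ 2)%:R * M%:R
          * (ln (M.+1)%:R / ln 2) * phi)%:E)%E.
Proof.
move=> phi2 _ _ mu1 M1 nu1 _ sep smooth.
have phi0 : 0 <= phi by apply: le_trans phi2; rewrite invr_ge0.
have [D Dsize DE] := separable_differences mu1 sep.
pose eps (t : nat) : R := (nu * M)%:R / t.+1%:R.
have eps0 t : 0 <= eps t by rewrite divr_ge0.
have mgap t := gap_event_measurable smooth D (eps t).
apply: (@le_trans _ _
  (\int[P]_w (\sum_(t < M.+1 ^ nu) (\1_(gap_event c D (eps t)) w)%:E))%E).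
  (* Pointwise domination suffices here: only the sum of indicators has to be measurable. *)
  apply: ge0_le_integral_nonmeasurable => w; first by rewrite lee_fin.
  by rewrite sumEFin lee_fin longest_path_le_sum_gap.
rewrite ge0_integral_sum//; last first.
  by move=> t; apply/measurable_EFinP; exact: measurable_indic.
apply: (@le_trans _ _
  (\sum_(t < M.+1 ^ nu) ((size D)%:R * (phi * eps t))%:E)%E).
  apply: lee_sum => t _; rewrite integral_indic// setIT.
  exact: gap_event_le.
rewrite sumEFin lee_fin /eps.
under eq_bigr => t _ do rewrite !mulrA.
rewrite -mulr_sumr.
have := harmonic_log2_le R M1 nu1; set H := \sum_(_ < _) _ => H_le.
apply: (@le_trans _ _ ((lam * mu ^ beta)%:R * phi * (nu * M)%:R
    * (3 * nu%:R * (ln M.+1%:R / ln 2)))).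
  apply: ler_pM => //; first by rewrite !mulr_ge0.
    by apply: sumr_ge0 => t _; rewrite invr_ge0.
  by rewrite !ler_wpM2r// ler_nat.
by rewrite le_eqVlt; apply/orP; left; apply/eqP; rewrite !natrM natrX; ring.
Qed.
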